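(* Let $K,L,M$ be positive integers and let $(F_{1:K};\mathbf{w})\in\Theta_{K,L,M}$ satisfy $\mathcal{L}_w(F_{1:K};\mathbf{w})\ge 2K$. Then the mixture model with latent parameters $(F_{1:K};\mathbf{w})$ is identifiable.
   Context: $[N]=\{1,\dots,N\}$. $\Delta_M=\{\mathbf{x}\in\mathbb{R}^M:\sum_{m=1}^M x_m=1,\ x_m>0\ \forall m\in[M]\}$ and $\overline{\Delta}_M$ is its closure. $\Theta_{K,L,M}$ is the set of latent parameters $(F_{1:K};\mathbf{w})$, where $\mathbf{w}=(w_1,\dots,w_K)\in\Delta_K$ and $F_{1:K}=(F_1,\dots,F_K)$ is an ordered tuple of matrices $F_k=(f_{k\ell m})_{\ell\in[L],m\in[M]}$, each row $\mathbf{f}_{k\ell}=(f_{k\ell 1},\dots,f_{k\ell M})$ of which lies in $\overline{\Delta}_M$. $\overline{\Theta}_{K,L,M}$ is its closure (the same, but with $\mathbf{w}\in\overline{\Delta}_K$). The mixture distribution $\mathbf{f}$ of $(F_{1:K};\mathbf{w})\in\overline{\Theta}_{K,L,M}$ is $\mathbf{f}(m_1,\dots,m_L)=\sum_{k=1}^K w_k\prod_{\ell=1}^L f_{k\ell m_\ell}$ for $(m_1,\dots,m_L)\in[M]^L$. Write $(F_{1:K};\mathbf{w})\approx(G_{1:K};\mathbf{z})$ if there is a permutation $\pi$ of $[K]$ with $F_k=G_{\pi(k)}$ and $w_k=z_{\pi(k)}$ for all $k\in[K]$. The mixture model with latent parameters $(F_{1:K};\mathbf{w})\in\Theta_{K,L,M}$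 and mixture distribution $\mathbf{f}$ is identifiable iff for every $(G_{1:K};\mathbf{z})\in\overline{\Theta}_{K,L,M}$ whose mixture distribution $\mathbf{g}$ satisfies $\mathbf{g}=\mathbf{f}$, we have $(F_{1:K};\mathbf{w})\approx(G_{1:K};\mathbf{z})$. The $\ell$-th variable ($\ell\in[L]$) is weakly separable in $(F_{1:K};\mathbf{w})$ iff there is an $m\in[M]$ such that for all distinct $k,k'\in[K]$, $f_{k\ell m}\ne f_{k'\ell m}$. $\mathcal{L}_w(F_{1:K};\mathbf{w})$ is the number of $\ell\in[L]$ that are weakly separable. *)

(* Defs.v *)
From HB Require Import structures.
From mathcomp Require Import all_boot all_order all_algebra all_fingroup.
From mathcomp Require Import all_classical all_reals all_analysis.
From mathcomp Require Import lra.
Import Order.TTheory GRing.Theory Num.Theory.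
Import numFieldNormedType.Exports.

Set Implicit Arguments.
Unset Strict Implicit.
Unset Printing Implicit Defensive.

Local Open Scope classical_set_scope.
Local Open Scope ring_scope.

Definition simplex (R : realType) (M : nat) : set 'rV[R]_M :=
  [set x | \sum_(m < M) x 0 m = 1 /\ forall m, 0 < x 0 m].

(* The topological closure, for the entrywise (product) topology on 'rV[R]_M. *)
Definition closed_simplex (R : realType) (M : nat) : set 'rV[R]_M :=
  closure (simplex (M := M)).

Lemma closed_simplexE (R : realType) (M : nat) : (0 < M)%N ->
  closed_simplex (R := R) (M := M) =
  [set x | \sum_(m < M) x 0 m = 1 /\ forall m, 0 <= x 0 m].
Proof.
case: M => // n _; apply/seteqP; split=> [x clx | x [x1 x0] B /nbhs_ballP[e /= e0 eB]].
- have near e : 0 < e ->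
      exists2 y : 'rV[R]_n.+1, simplex y & forall m, `|x 0 m - y 0 m| < e.
    move=> e0; have [y [sy [_ xy]]] := clx _ (nbhsx_ballx x e e0).
    by exists y => // m; have := xy 0 m; rewrite /ball /=.
  split; last first.
    move=> m; rewrite leNgt; apply/negP => xm.
    have [|y [_ /(_ m) y0] /(_ m)] := near (- x 0 m); first by rewrite oppr_gt0.
    by rewrite ltr_norml => /andP[+ _]; lra.
  apply/eqP; rewrite -subr_eq0 -normr_le0; apply/ler_addgt0Pr => d d0; rewrite add0r.
  have n0 : 0 < n.+1%:R :> R by rewrite ltr0n.
  have [y [y1 _] xy] := near _ (divr_gt0 d0 n0).
  rewrite -y1 -sumrB (le_trans (ler_norm_sum _ _ _)) //.
  apply: (@le_trans _ _ (\sum_(m < n.+1) d / n.+1%:R)).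
    by apply: ler_sum => m _; exact: ltW.
  by rewrite sumr_const card_ord -(mulr_natr (d / _)) divfK // gt_eqF.
- have n0 : 0 < n.+1%:R^-1 :> R by rewrite invr_gt0 ltr0n.
  have n1 : n.+1%:R^-1 <= 1 :> R by rewrite invf_le1 ?ltr0n // ler1n.
  pose t := Num.min (e / 2) 1.
  have t0 : 0 < t by rewrite /t lt_min ltr01 andbT divr_gt0.
  have te : t < e.
    by rewrite /t gt_min ltr_pdivrMr // ltr_pMr // ltr1n.
  have t1 : t <= 1 by rewrite /t ge_min lexx orbT.
  exists (\row_m ((1 - t) * x 0 m + t * n.+1%:R^-1)); split.
    split=> [|m]; last by rewrite mxE ltr_wpDl ?mulr_gt0 // mulr_ge0 // subr_ge0.
    under eq_bigr do rewrite mxE.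
    rewrite big_split /= -mulr_sumr x1 sumr_const card_ord -(mulr_natr (t / _)).
    by rewrite divfK ?pnatr_eq0 // mulr1 subrK.
  apply: eB; split=> // i m; rewrite ord1 /ball /= mxE.
  have xm1 : x 0 m <= 1.
    by rewrite -x1 (bigD1 m) //= lerDl sumr_ge0.
  rewrite ltr_norml; have := x0 m; set u := x 0 m in xm1 *; set v := _^-1 in n0 n1 *.
  by move=> u0; apply/andP; split; nra.
Qed.

(* [component p k] is the L x M matrix F_k, whose row l is f_{kl};
   indices range over 'I_n = {0, ..., n-1} instead of {1, ..., n}. *)
Record latent (R : realType) (K L M : nat) := Latent {
  component : 'I_K -> 'M[R]_(L, M);
  weight : 'rV[R]_K }.

Definition Theta (R : realType) (K L M : nat) : set (latent R K L M) :=
  [set p | simplex (weight p) /\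
           forall k l, closed_simplex (row l (component p k))].

Definition closed_Theta (R : realType) (K L M : nat) : set (latent R K L M) :=
  [set p | closed_simplex (weight p) /\
           forall k l, closed_simplex (row l (component p k))].

Definition mixture (R : realType) (K L M : nat) (p : latent R K L M)
    (m : {ffun 'I_L -> 'I_M}) : R :=
  \sum_(k < K) weight p 0 k * \prod_(l < L) component p k l (m l).

Definition latent_equiv (R : realType) (K L M : nat) (p q : latent R K L M) :
    Prop :=
  exists s : {perm 'I_K}, forall k,
    component p k = component q (s k) /\ weight p 0 k = weight q 0 (s k).

Definition identifiable (R : realType) (K L M : nat) (p : latent R K L M) :
    Prop :=
  forall q, closed_Theta q -> mixture q =1 mixture p -> latent_equiv p q.

Definition weakly_separable (R : realType) (K L M : nat) (p : latent R K L M)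
    (l : 'I_L) : bool :=
  [exists m : 'I_M, forall k : 'I_K, forall k' : 'I_K,
     (k != k') ==> (component p k l m != component p k' l m)].

Definition num_weakly_separable (R : realType) (K L M : nat)
    (p : latent R K L M) : nat :=
  #|[set l : 'I_L | weakly_separable p l]%SET|.

(* Main.v *)
(* Let [p = (F, w)] and [q = (G, z)] have the same mixture distribution, and let
   [A], [B] be disjoint sets of [K - 1] separable variables.  For each component
   [i] of [F], a product over [A] of factors [1_{m l} - f_{t l, l, m l}], with [t]
   mapping [A] onto the other components, is a test function whose mean vanishes
   under every component of [F] but [i]; likewise for [B].  Pairing the two
   families of test functions, with and without an indicator of a further
   variable [c], gives two simultaneously diagonalised matrices, whose comparison
   matches the [c]-th rows of [F] and [G] along a permutation valid for all [c]
   outside [A] and [B].  With [2K] separable variables one of them, [c], can be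
   kept out of [A] and [B] together with any other given variable; since [c] is
   separable it determines the permutation, which is therefore the same for all
   variables. *)
Require Import Defs.
From HB Require Import structures.
From mathcomp Require Import all_boot all_order all_algebra all_fingroup.
From mathcomp Require Import all_classical all_reals all_analysis.
From mathcomp Require Import ring zify.
Import Order.TTheory GRing.Theory Num.Theory.
Import numFieldNormedType.Exports.

Local Open Scope ring_scope.

(** * Finite sets of prescribed size *)

Lemma subset_of_card {T : finType} (S : {set T}) (n : nat) : (n <= #|S|)%N ->
  exists2 A : {set T}, A \subset S & #|A| = n.
Proof.
rewrite -bin_gt0 -cards_draws card_gt0 => /set0Pn[A].
by rewrite inE => /andP[AS /eqP An]; exists A.
Qed.

Lemma disjoint_subsets_of_card {T : finType} (S : {set T}) (n : nat) :
  (n.*2 <= #|S|)%N ->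
  exists A B : {set T},
    [/\ A \subset S, B \subset S, [disjoint A & B], #|A| = n & #|B| = n].
Proof.
rewrite -addnn => nS.
have [A AS An] := subset_of_card S n (leq_trans (leq_addr _ _) nS).
have [|B] := subset_of_card (S :\: A) n.
  by rewrite cardsDS // An leq_subRL ?subset_leq_card // -An subset_leq_card.
rewrite subsetD disjoint_sym => /andP[BS AB] Bn.
by exists A, B.
Qed.

Lemma disjoint_set0 {T : finType} (A : {set T}) : [disjoint finset.set0 & A].
Proof. by apply: eq_disjoint0 => x; rewrite inE. Qed.

Lemma imset_of_card {aT rT : finType} (y : rT) (A : {set aT}) (B : {set rT}) :
  #|A| = #|B| -> exists f : aT -> rT, [set f x | x in A] = B.
Proof.
(* Elements of equal rank in [enum A] and [enum B] correspond; [y] is the value outside [A]. *)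
move=> AB; exists (fun x => nth y (enum B) (index x (enum A))).
apply/setP=> b; apply/imsetP/idP => [[x xA ->]|bB].
  by rewrite -mem_enum mem_nth // -cardE -AB cardE index_mem mem_enum.
have bA : (index b (enum B) < size (enum A))%N.
  by rewrite -cardE AB cardE index_mem mem_enum.
have [x0] : {x0 | x0 \in A}.
  apply/sigW/set0Pn; rewrite -card_gt0 cardE; exact: leq_ltn_trans bA.
move=> _; exists (nth x0 (enum A) (index b (enum B))).
  by rewrite -mem_enum mem_nth.
by rewrite index_uniq ?enum_uniq // nth_index // mem_enum.
Qed.

(** * Determinants and simultaneous diagonalisation *)

Lemma det_neq0_perm {F : fieldType} {n : nat} (G : 'M[F]_n) : \det G != 0 ->
  exists s : {perm 'I_n}, forall i, G i (s i) != 0.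
Proof.
move=> G0; have [s /prodf_neq0 Gs|no] := pickP (fun s : {perm 'I_n} =>
  \prod_i G i (s i) != 0).
  by exists s => i; exact: Gs.
case/eqP: G0; rewrite /determinant big1 // => s _.
by have /negbFE/eqP-> := no s; rewrite mulr0.
Qed.

(* In matrix form [G Z H^T = D] and [G Z X H^T = D Y] with [Z], [D], [X], [Y]
   diagonal and [D] invertible, so [G X = Y G]: [X] and [Y] agree along every
   nonzero entry of [G], and a nonzero term of [\det G] selects such entries. *)
Lemma simultaneous_diag_perm {F : fieldType} {n : nat} (G H : 'I_n -> 'I_n -> F)
    (z d : 'I_n -> F) : (forall i, d i != 0) ->
  (forall i j, \sum_s z s * (G i s * H j s) = d i *+ (i == j)) ->
  exists s : {perm 'I_n}, forall x y : 'I_n -> F,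
    (forall i j, \sum_k z k * (x k * (G i k * H j k)) = d i * y i *+ (i == j)) ->
    forall i, x (s i) = y i.
Proof.
move=> d0 GH; pose Gm := \matrix_(i, k) G i k.
(* With the weights absorbed here, [Hm] is invertible by the determinant identity below, although
   nothing is assumed about [z]. *)
pose Hm := \matrix_(k, j) (z k * H j k).
have GHm : Gm *m Hm = diag_mx (\row_i d i).
  apply/matrixP=> i j; rewrite !mxE -GH.
  by apply: eq_bigr => k _; rewrite !mxE mulrCA.
have := congr1 determinant GHm; rewrite det_mulmx det_diag => detGH.
have : \det Gm * \det Hm != 0.
  by rewrite detGH; apply/prodf_neq0 => i _; rewrite mxE.
rewrite mulf_eq0 negb_or => /andP[/det_neq0_perm[s Gs] H0].
exists s => x y GxH i; have Hu : Hm \in unitmx by rewrite unitmxE unitfE.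
suff : Gm *m diag_mx (\row_k x k) = diag_mx (\row_i y i) *m Gm.
  rewrite mul_mx_diag mul_diag_mx => /matrixP/(_ i (s i)).
  by have := Gs i; rewrite !mxE => Gi; rewrite mulrC => /(mulIf Gi).
apply: (can_inj (mulmxK Hu)); rewrite -[RHS]mulmxA GHm mulmx_diag mul_mx_diag.
apply/matrixP=> k j; rewrite !mxE mulrC -GxH.
by apply: eq_bigr => t _; rewrite !mxE; ring.
Qed.

(** * Moments of product test functions *)

Definition mean {R : realType} {K L M : nat} (p : latent R K L M) (k : 'I_K)
    (l : 'I_L) (phi : 'I_M -> R) : R :=
  \sum_(j < M) component p k l j * phi j.

Definition stochastic {R : realType} {K L M : nat} (p : latent R K L M) : Prop :=
  forall k l, \sum_(j < M) component p k l j = 1.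

Lemma mean1 {R : realType} {K L M : nat} (p : latent R K L M) k l :
  stochastic p -> mean p k l (fun=> 1) = 1.
Proof. by move=> p1; rewrite -[RHS](p1 k l); apply: eq_bigr => j _; rewrite mulr1. Qed.

Lemma mean_delta {R : realType} {K L M : nat} (p : latent R K L M) k l m :
  mean p k l (fun j => (j == m)%:R) = component p k l m.
Proof.
rewrite /mean (bigD1 m) //= eqxx mulr1 big1 ?addr0 // => j /negbTE->.
by rewrite mulr0.
Qed.

Lemma meanBc {R : realType} {K L M : nat} (p : latent R K L M) k l phi c :
  stochastic p -> mean p k l (fun j => phi j - c) = mean p k l phi - c.
Proof.
move=> p1; rewrite /mean -[c in RHS]mul1r -(p1 k l) mulr_suml -sumrB.
by apply: eq_bigr => j _; rewrite mulrBr.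
Qed.

(** Within one component the variables are independent, so the expectation of a product
    factorises. *)
Lemma mixture_moment {R : realType} {K L M : nat} (p : latent R K L M)
    (phi : 'I_L -> 'I_M -> R) :
  \sum_(m : {ffun 'I_L -> 'I_M}) mixture p m * \prod_l phi l (m l) =
  \sum_k weight p 0 k * \prod_l mean p k l (phi l).
Proof.
under eq_bigr do rewrite /mixture mulr_suml.
rewrite exchange_big /=; apply: eq_bigr => k _.
rewrite /mean bigA_distr_bigA mulr_sumr; apply: eq_bigr => m _.
by rewrite -mulrA -big_split.
Qed.

(** Each such moment depends on the mixture alone: variables outside the three sets get the test
    function 1, whose mean is 1. *)
Lemma moment_eq {R : realType} {K L M : nat} (p q : latent R K L M)
    (A B C : {set 'I_L}) (phi psi chi : 'I_L -> 'I_M -> R) :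
  stochastic p -> stochastic q -> mixture q =1 mixture p ->
  [disjoint A & B] -> [disjoint C & A :|: B] ->
  let moment r := \sum_(k < K) weight r 0 k *
    (\prod_(l in C) mean r k l (chi l) *
      (\prod_(l in A) mean r k l (phi l) * \prod_(l in B) mean r k l (psi l))) in
  moment q = moment p.
Proof.
move=> p1 q1 pq AB CAB moment.
pose Phi l := if l \in C then chi l else if l \in A then phi l
              else if l \in B then psi l else fun=> 1.
suff momentE r : stochastic r ->
    moment r = \sum_(m : {ffun 'I_L -> 'I_M}) mixture r m * \prod_l Phi l (m l).
  by rewrite !momentE //; apply: eq_bigr => m _; rewrite pq.
move=> r1; rewrite mixture_moment; apply: eq_bigr => k _; congr (_ * _).
rewrite [X in X * _]big_mkcond [X in _ * (X * _)]big_mkcond.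
rewrite [X in _ * (_ * X)]big_mkcond -!big_split /=; apply: eq_bigr => l _.
rewrite /Phi; have [lC|lC] := boolP (l \in C).
  have := disjointFr CAB lC; rewrite !inE => /norP[/negbTE-> /negbTE->].
  by rewrite !mulr1.
have [lA|lA] := boolP (l \in A); first by rewrite (disjointFr AB lA) mul1r mulr1.
by case: ifP => _; rewrite ?mean1 ?mul1r.
Qed.

(** * Isolating and matching components *)

Definition probe {R : realType} {K L M : nat} (p : latent R K L M)
    (m : 'I_L -> 'I_M) (t : 'I_L -> 'I_K) (l : 'I_L) (j : 'I_M) : R :=
  (j == m l)%:R - component p (t l) l (m l).

(** The factor at [l] vanishes under component [t l], and [t] reaches every component but [i];
    separability keeps all factors nonzero under [i]. *)
Lemma probe_neq0 {R : realType} {K L M : nat} (p : latent R K L M)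
    (m : 'I_L -> 'I_M) (t : 'I_L -> 'I_K) (A : {set 'I_L}) (i k : 'I_K) :
  stochastic p ->
  {in A, forall l, injective (fun k => component p k l (m l))} ->
  [set t l | l in A] = [set~ i] ->
  (\prod_(l in A) mean p k l (probe p m t l) != 0) = (k == i).
Proof.
move=> p1 sep tA; have := in_setC1 k i; rewrite -tA => kt.
have [->|ki] := eqVneq k i.
  apply/prodf_neq0 => l lA; rewrite meanBc // mean_delta subr_eq0.
  apply/eqP => /(sep l lA) it; have := imset_f t lA.
  by rewrite tA -it !inE eqxx.
move: kt; rewrite ki => /imsetP[l lA kE]; apply/negbTE; rewrite negbK.
by rewrite (bigD1 l) //= meanBc // mean_delta -kE subrr mul0r.
Qed.

Lemma components_aligned {R : realType} {K L M : nat} (p q : latent R K L M)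
    (m : 'I_L -> 'I_M) (A B : {set 'I_L}) :
  stochastic p -> stochastic q -> mixture q =1 mixture p ->
  (forall k, weight p 0 k != 0) ->
  {in A :|: B, forall l, injective (fun k => component p k l (m l))} ->
  [disjoint A & B] -> #|A| = K.-1 -> #|B| = K.-1 ->
  exists s : {perm 'I_K}, forall k l, l \notin A :|: B ->
    forall j, component q (s k) l j = component p k l j.
Proof.
move=> p1 q1 pq w0 sep AB cA cB.
have cC (i : 'I_K) : #|[set~ i]| = K.-1 by rewrite cardsC1 card_ord.
have sepA : {in A, forall l, injective (fun k => component p k l (m l))}.
  by move=> l lA; apply: sep; rewrite inE lA.
have sepB : {in B, forall l, injective (fun k => component p k l (m l))}.
  by move=> l lB; apply: sep; rewrite inE lB orbT.
have [tA tAE] := boolp.choice (fun i =>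
  imset_of_card i A [set~ i] (etrans cA (esym (cC i)))).
have [tB tBE] := boolp.choice (fun i =>
  imset_of_card i B [set~ i] (etrans cB (esym (cC i)))).
pose G (r : latent R K L M) (i k : 'I_K) := \prod_(l in A) mean r k l (probe p m (tA i) l).
pose H (r : latent R K L M) (i k : 'I_K) := \prod_(l in B) mean r k l (probe p m (tB i) l).
have Gp i k : (G p i k != 0) = (k == i) by apply: probe_neq0.
have Hp i k : (H p i k != 0) = (k == i) by apply: probe_neq0.
pose d i := weight p 0 i * (G p i i * H p i i).
have d0 i : d i != 0 by rewrite !mulf_neq0 ?Gp ?Hp.
(* Under [p] the factor [G p i] leaves only the term [k = i], and [H p j] then forces [i = j]. *)
have pE (x : 'I_K -> R) i j :
    \sum_k weight p 0 k * (x k * (G p i k * H p j k)) = d i * x i *+ (i == j).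
  rewrite (bigD1 i) //= big1 ?addr0 => [|k ki].
    have [<-|ij] := eqVneq i j; first by rewrite mulr1n /d; ring.
    have /eqP-> : H p j i == 0 by rewrite -[_ == 0]negbK Hp.
    by rewrite !mulr0.
  have /eqP-> : G p i k == 0 by rewrite -[_ == 0]negbK Gp.
  by rewrite mul0r !mulr0.
have [|s sE] := simultaneous_diag_perm (G q) (H q) (weight q 0) d d0.
  move=> i j; have := pE (fun=> 1) i j; rewrite mulr1 => <-.
  have := moment_eq p q A B finset.set0 (probe p m (tA i)) (probe p m (tB j))
    (fun _ _ => 1) p1 q1 pq AB (disjoint_set0 _).
  move=> /= pqE; etransitivity; last (etransitivity; first exact: pqE).
    by apply: eq_bigr => k _; rewrite big_set0 mul1r.
  by apply: eq_bigr => k _; rewrite big_set0 mul1r.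
exists s => k l lAB j.
(* [s] was fixed before [l] and [j], so it serves them all; the indicator of [j] at variable [l] has
   the entry at [l], [j] as its mean. *)
apply: (sE (fun k => component q k l j) (fun k => component p k l j)) => i i'.
rewrite -(pE (fun k => component p k l j)); have /= := moment_eq p q A B [set l] (probe p m (tA i))
  (probe p m (tB i')) (fun _ a => (a == j)%:R) p1 q1 pq AB.
rewrite disjoints1 => /(_ lAB) pqE.
etransitivity; last (etransitivity; first exact: pqE).
  by apply: eq_bigr => ? _; rewrite big_set1 mean_delta.
by apply: eq_bigr => ? _; rewrite big_set1 mean_delta.
Qed.

(** Once components are matched, one test function isolating [i] in [p] also isolates [s i] in [q],
    with the same nonzero mean; equal moments then give equal weights. *)
Lemma weights_aligned {R : realType} {K L M : nat} (p q : latent R K L M)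
    (m : 'I_L -> 'I_M) (A : {set 'I_L}) (s : {perm 'I_K}) :
  stochastic p -> stochastic q -> mixture q =1 mixture p ->
  {in A, forall l, injective (fun k => component p k l (m l))} ->
  #|A| = K.-1 -> (forall k, component p k = component q (s k)) ->
  forall k, weight p 0 k = weight q 0 (s k).
Proof.
move=> p1 q1 pq sep cA sE i.
have [|t tE] := imset_of_card i A [set~ i]; first by rewrite cA cardsC1 card_ord.
pose G (r : latent R K L M) (k : 'I_K) := \prod_(l in A) mean r k l (probe p m t l).
have Gp k : (G p k != 0) = (k == i) by apply: probe_neq0.
have sG k : G q (s k) = G p k by rewrite /G /mean sE.
have A0 : [disjoint A & finset.set0].
  by rewrite disjoint_sym disjoint_set0.
have /= pqE := moment_eq p q A finset.set0 finset.set0 (probe p m t) (fun _ _ => 1)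
    (fun _ _ => 1) p1 q1 pq A0 (disjoint_set0 _).
apply: (@mulIf _ (G p i)); first by rewrite Gp.
transitivity (\sum_k weight p 0 k * G p k).
  rewrite (bigD1 i) //= big1 ?addr0 // => k ki.
  have /eqP-> : G p k == 0 by rewrite -[_ == 0]negbK Gp.
  by rewrite mulr0.
transitivity (\sum_k weight q 0 k * G q k).
  etransitivity; last (etransitivity; first exact: esym pqE).
    by apply: eq_bigr => k _; rewrite !big_set0 mul1r mulr1.
  by apply: eq_bigr => k _; rewrite !big_set0 mul1r mulr1.
rewrite (reindex_perm s) /= (bigD1 i) //= big1 ?addr0 ?sG // => k ki.
have /eqP-> : G q (s k) == 0 by rewrite sG -[_ == 0]negbK Gp.
by rewrite mulr0.
Qed.

Theorem theorem2 (R : realType) (K L M : nat)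
    (hK : (0 < K)%N) (hL : (0 < L)%N) (hM : (0 < M)%N)
    (p : latent R K L M) (hp : Theta p)
    (hsep : (2 * K <= num_weakly_separable p)%N) :
  identifiable p.
Proof.
case: hp => [[_ w_gt0] pS] q [_ qS] pq.
have p1 : stochastic p.
  move=> k l; have := pS k l; rewrite closed_simplexE // => -[<- _].
  by apply: eq_bigr => j _; rewrite mxE.
have q1 : stochastic q.
  move=> k l; have := qS k l; rewrite closed_simplexE // => -[<- _].
  by apply: eq_bigr => j _; rewrite mxE.
have w0 k : weight p 0 k != 0 by rewrite gt_eqF.
pose S := [set l | weakly_separable p l]%SET.
have {}hsep : (K.*2 <= #|S|)%N by rewrite -mul2n.
have [|m sep] := @boolp.choice _ _ (fun l a => l \in S ->
    injective (fun k => component p k l a)).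
  move=> l.
  have [/existsP[a aP]|] := boolP (weakly_separable p l); last first.
    (* Off [S] the claim is vacuous and any value serves. *)
    by move=> /negbTE lS; exists (Ordinal hM); rewrite inE lS.
  exists a => _ k k' /eqP kk'; apply: contraTeq kk' => kk'.
  by have /forallP/(_ k)/forallP/(_ k')/implyP/(_ kk') := aP.
have [c cS] : exists c, c \in S by apply/set0Pn; rewrite -card_gt0; lia.
have align l : exists s : {perm 'I_K}, forall k l', l' \in [set c; l]%SET ->
    forall j, component q (s k) l' j = component p k l' j.
  (* Removing [c] and [l] leaves at least [2K - 2] separable variables, enough for two sets of
     [K - 1]. *)
  have [|A [B [AS BS AB cA cB]]] := disjoint_subsets_of_card (S :\: [set c; l]) K.-1.
    have := cardsID [set c; l] S; have := subset_leq_card (subsetIr S [set c; l]).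
    by rewrite cards2; case: (c != l); lia.
  have ABS : A :|: B \subset S :\: [set c; l] by rewrite finset.subUset AS.
  have [|s sE] := components_aligned p q m A B p1 q1 pq w0 _ AB cA cB.
    by move=> l' /(fintype.subsetP ABS); rewrite inE => /andP[_ /sep].
  exists s => k l' l'cl; apply: sE; apply/negP => /(fintype.subsetP ABS).
  by rewrite inE l'cl.
have [s sE] := align c.
have sF k : component p k = component q (s k).
  apply/matrixP => l j; have [t tE] := align l.
  (* Row [c] is known to separate the components of [p], so [t k] is pulled back to [p] along the
     inverse of [s]. *)
  suff -> : s k = t k by rewrite tE // !inE eqxx orbT.
  apply: (can_inj (permKV s)); rewrite permK; apply: (sep c cS).
  by rewrite /= -[RHS]sE ?permKV ?tE // !inE eqxx.
have [A AS cA] : exists2 A : {set 'I_L}, A \subset S & #|A| = K.-1.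
  by apply: subset_of_card; apply: leq_trans hsep; lia.
exists s => k; split=> //.
apply: (weights_aligned p q m A s) => // l /(fintype.subsetP AS); exact: sep.
Qed.
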